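(* Let $(W,S)$ be an arbitrary Coxeter system and let $\omega=(\omega_1,\dots,\omega_m)$ be a finite word in the generators $S$. The collection of index sets of $\omega$-sorted words, $$\mathscr{F}:=\{I(\alpha)\subseteq I(\omega):\alpha\subseteq\omega\text{ is }\omega\text{-sorted}\},$$ is a supersolvable antimatroid with respect to the natural order on the ground set $E:=I(\omega)=\{1,\dots,m\}$.
   Context: $\ell$ denotes the length function of $(W,S)$. A subword $\alpha\subseteq\omega$ is identified with its index set $I(\alpha)=\{i_1<\dots<i_k\}\subseteq I(\omega)=\{1,\dots,m\}$, with $\alpha=(\omega_{i_1},\dots,\omega_{i_k})$; two subwords are equal when their index sets are equal. For a word $\alpha=(\alpha_1,\dots,\alpha_k)$ in $S$ write $\langle\alpha\rangle=\alpha_1\cdots\alpha_k\in W$; $\alpha$ is reduced if $k=\ell(\langle\alpha\rangle)$. For $A,B\subseteq I(\omega)$, $A\leq_{\mathsf{lex}}B$ means $A=B$ or $\min((A\cup B)\setminus(A\cap B))\in A$. A subword $\alpha\subseteq\omega$ is $\omega$-sorted if it is reduced and $I(\alpha)=\min_{\leq_{\mathsf{lex}}}\{I(\beta)\subseteq I(\omega):\beta\text{ is reduced and }\langle\beta\rangle=\langle\alpha\rangle\}$. For a totally ordered set $(E,\leq_E)$ and $\mathscr{F}\subseteq 2^E$ (the feasible sets), $(E,\mathscr{F},\leq_E)$ is a supersolvable antimatroid if $\emptyset\in\mathscr{F}$ and for all $A,B\in\mathscr{F}$ with $B\not\subseteq A$, setting $x=\min_{\leq_E}(B\setminus A)$,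 one has $A\cup\{x\}\in\mathscr{F}$. *)

(* Defs.v *)
From mathcomp Require Import all_boot all_order.
From mathcomp Require Import boolp classical_sets.

Set Implicit Arguments.
Unset Strict Implicit.
Unset Printing Implicit Defensive.

Local Open Scope group_scope.

Section Coxeter.

Variables (W : groupType) (S : set W).

(* [0] encodes the entry [oo]; only entries indexed by [S] matter. *)
Definition coxeter_matrix (M : W -> W -> nat) : Prop :=
  forall s t, S s -> S t -> M s t = M t s /\ (M s t = 1%N <-> s = t).

(* [f] satisfies the relations (s t)^(M s t) = 1.  For [M s t = 0], i.e. an
   infinite entry, the relation is vacuous since [x ^+ 0 = 1]. *)
Definition satisfies_relations (M : W -> W -> nat) (G : groupType)
    (f : W -> G) : Prop :=
  forall s t, S s -> S t -> (f s * f t) ^+ M s t = 1.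

(* [W] has the presentation < S | (s t)^(M s t) = 1 >, expressed by the
   universal property.  A multiplicative map between groups is a group
   morphism. *)
Definition presented_by (M : W -> W -> nat) : Prop :=
  satisfies_relations M (fun w : W => w) /\
  forall (G : groupType) (f : W -> G), satisfies_relations M f ->
    (exists g : {multiplicative W -> G}, forall s, S s -> g s = f s) /\
    (forall g h : {multiplicative W -> G},
       (forall s, S s -> g s = f s) -> (forall s, S s -> h s = f s) ->
       forall w, g w = h w).

Definition coxeter_system : Prop :=
  exists M, coxeter_matrix M /\ presented_by M.

Definition word_in (a : seq W) : Prop := forall s, s \in a -> S s.

Definition word_prod (a : seq W) : W := \prod_(s <- a) s.

(* The default value [0] is irrelevant: it is only returned outside of the
   submonoid generated by [S], which is all of [W] in a Coxeter system. *)
Definition coxeter_length (w : W) : nat :=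
  let is_len k := exists a, [/\ word_in a, word_prod a = w & size a = k] in
  xget 0%N [set k | is_len k /\ forall j, is_len j -> (k <= j)%N].

Definition reduced (a : seq W) : Prop := size a = coxeter_length (word_prod a).

End Coxeter.

Section OrderedSets.

Variables (d : Order.disp_t) (E : finOrderType d).

Definition is_min (X : {set E}) (x : E) : Prop :=
  x \in X /\ forall y, y \in X -> (x <= y)%O.

Definition lex_le (A B : {set E}) : Prop :=
  A = B \/ exists2 x, is_min ((A :|: B) :\: (A :&: B)) x & x \in A.

Definition is_lex_min (P : set {set E}) (A : {set E}) : Prop :=
  P A /\ forall B, P B -> lex_le A B.

Definition supersolvable_antimatroid (F : set {set E}) : Prop :=
  F finset.set0 /\
  forall A B : {set E}, F A -> F B -> ~~ (B \subset A) ->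
    exists2 x, is_min (B :\: A) x & F (x |: A).

End OrderedSets.

Section Sorted.

Variables (W : groupType) (S : set W) (m : nat) (omega : m.-tuple W).

(* Positions are numbered from 0 ; [enum I] lists [I] in increasing order. *)
Definition subword (I : {set 'I_m}) : seq W := [seq tnth omega i | i <- enum I].

Definition omega_sorted (I : {set 'I_m}) : Prop :=
  reduced S (subword I) /\
  is_lex_min [set J : {set 'I_m} | reduced S (subword J) /\
                word_prod (subword J) = word_prod (subword I)]%classic I.

Definition sorted_sets : set {set 'I_m} := [set I | omega_sorted I]%classic.

End Sorted.

(* Main.v *)
(** Letting [W] act on (reflections) x (signs), encoded as the group of pairs
    (w, set of reflections) with the twisted symmetric difference, the universal
    property yields a cocycle [N] with [N w t] iff the reflection [t] is a left
    inversion of [w]; this gives the exchange condition and the subword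
    characterisation of the Bruhat order.

    A reduced [A] is sorted iff for every position [i] outside [A], prepending
    [omega_i] to the part of [A] after [i] keeps it reduced: otherwise exchange
    produces a lexicographically smaller word for the same element.  Let [A], [B]
    be sorted and x = min (B \ A).  If [omega_x] were a right descent of the
    element u of A_(<x), the lifting property would produce, inside A_(<x), a
    reduced word for the element of B_(<=x), hence a sorted word for it avoiding
    [x], contradicting the uniqueness of the sorted word B_(<=x).  So inserting
    [x] into [A] keeps it reduced, and the same argument for {j} + A_(>j) in
    place of [A] shows that A + x satisfies the sortedness criterion at each
    j < x. *)
From HB Require Import structures.
Require Import Defs.
From mathcomp Require Import all_boot all_order.
From mathcomp Require Import boolp classical_sets.

Set Implicit Arguments.
Unset Strict Implicit.
Unset Printing Implicit Defensive.

Local Open Scope group_scope.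

(* A pair (w, X) with X a set of elements of W (only reflections matter); the
   product is (u, X)(v, Y) = (uv, X + u Y u^-1), + being symmetric difference. *)
Record reflection_ext (W : Type) := RefExt { ext_elt : W; ext_set : W -> bool }.

(** * The twisted group that receives the Coxeter generators *)

Section ReflectionExt.

Variable W : groupType.
Implicit Types x y z : reflection_ext W.

HB.instance Definition _ := gen_eqMixin (reflection_ext W).
HB.instance Definition _ := gen_choiceMixin (reflection_ext W).

Definition ext_mul x y : reflection_ext W :=
  RefExt (ext_elt x * ext_elt y)
         (fun t => ext_set x t (+) ext_set y (t ^ ext_elt x)).
Definition ext_one : reflection_ext W := RefExt 1 (fun=> false).
Definition ext_inv x : reflection_ext W :=
  RefExt (ext_elt x)^-1 (fun t => ext_set x (t ^ (ext_elt x)^-1)).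

Fact ext_mulA : associative ext_mul.
Proof.
move=> x y z; congr RefExt => /=; first by rewrite mulgA.
by apply: funext => t; rewrite conjgM addbA.
Qed.

Fact ext_mul1 : left_id ext_one ext_mul.
Proof.
by case=> u f; congr RefExt => /=; rewrite ?mul1g //; apply: funext=> t; rewrite conjg1.
Qed.

Fact ext_mulr1 : right_id ext_one ext_mul.
Proof.
by case=> u f; congr RefExt => /=; rewrite ?mulg1 //; apply: funext=> t; rewrite addbF.
Qed.

Fact ext_mulV : left_inverse ext_one ext_inv ext_mul.
Proof.
case=> u f; congr RefExt => /=; rewrite ?mulVg //.
by apply: funext=> t; rewrite addbb.
Qed.

Fact ext_mulrV : right_inverse ext_one ext_inv ext_mul.
Proof.
case=> u f; congr RefExt => /=; rewrite ?mulgV //.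
by apply: funext=> t; rewrite conjgK addbb.
Qed.

HB.instance Definition _ := isGroup.Build (reflection_ext W)
  ext_mulA ext_mul1 ext_mulr1 ext_mulV ext_mulrV.

Fact ext_elt_mul : {morph (@ext_elt W) : x y / x * y}.
Proof. by []. Qed.

HB.instance Definition _ :=
  isMultiplicative.Build (reflection_ext W) W (@ext_elt W) ext_elt_mul.

Definition ext_gen (s : W) : reflection_ext W := RefExt s (fun t => t == s).

(* [(s t)^k s], for [k < 2n], is the k-th reflection of the word (s t)^n. *)
Lemma ext_gen_expg (s t : W) n : s * s = 1 -> t * t = 1 ->
  (ext_gen s * ext_gen t) ^+ n =
    RefExt ((s * t) ^+ n)
      (fun r => \big[addb/false]_(0 <= k < n.*2) (r == (s * t) ^+ k * s)).
Proof.
move=> ss tt.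
have sV : s^-1 = s by exact: mulg1_eq.
have tV : t^-1 = t by exact: mulg1_eq.
elim: n => [|n IHn].
  by congr RefExt; apply: funext => x; rewrite big_nil.
have conjE (x y : W) : (x ^ ((s * t) ^+ n) == y) = (x == y ^ ((s * t) ^- n)).
  by rewrite (can2_eq (conjgK _) (conjgKV _)).
(* Conjugation by [s] inverts [s * t]; this places the two reflections contributed by the last
   factor at ranks [2n] and [2n + 1] of the list. *)
have rotJ : s * ((s * t) ^- n) = (s * t) ^+ n * s.
  have cJ : (s * t) ^ s = (s * t)^-1.
    by rewrite conjgE invgM tV -[_ * _ * s]mulgA mulKg sV.
  by rewrite conjgCV sV conjVg conjXg cJ expVgn invgK.
rewrite expgSr IHn; congr RefExt => /=; first by rewrite -expgSr.
apply: funext => x; rewrite doubleS !big_nat_recr //= -addbA; congr (_ (+) (_ (+) _)).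
  rewrite conjE; congr (_ == _).
  by rewrite conjgE invgK rotJ -addnn expgnDr mulgA.
have -> : ((x ^ ((s * t) ^+ n)) ^ s == t) = (x ^ ((s * t) ^+ n) == s * t * s).
  by rewrite (can2_eq (conjgK s) (conjgKV s)) [t ^ _]conjgE invgK sV mulgA.
rewrite conjE conjgE invgK -mulgA rotJ.
by rewrite mulgA -expgSr mulgA -expgnDr addSn addnn.
Qed.

Lemma ext_gen_relation (s t : W) n : s * s = 1 -> t * t = 1 -> (s * t) ^+ n = 1 ->
  (ext_gen s * ext_gen t) ^+ n = 1.
Proof.
move=> ss tt stn; rewrite ext_gen_expg // stn; congr RefExt; apply: funext => x.
(* The reflections k and k + n coincide, so the 2n terms cancel in pairs. *)
rewrite -addnn (big_cat_nat (n := n)) ?leq_addr //=.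
rewrite -{2}[n]add0n big_addn addnK.
under [X in _ (+) X]eq_bigr => k _ do rewrite expgnDr stn mulg1.
by rewrite addbb.
Qed.

End ReflectionExt.

(** [N w] is the set component of the image of [w] under the morphism extending [ext_gen]; the
    twisted product law is the cocycle identity. *)
Lemma reflection_cocycle (W : groupType) (S : set W) : coxeter_system S ->
  (forall s, S s -> s * s = 1) /\
  exists N : W -> W -> bool,
    (forall u v t, N (u * v) t = N u t (+) N v (t ^ u)) /\
    (forall s t, S s -> N s t = (t == s)).
Proof.
case=> M [Mcox [Wrel Wuniv]].
have ss s : S s -> s * s = 1.
  move=> Ss; have [_ [_ /(_ erefl) Mss]] := Mcox s s Ss Ss.
  by have := Wrel s s Ss Ss; rewrite Mss.
split=> //.
have [|[g gS] _] := Wuniv (reflection_ext W) (@ext_gen W).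
  by move=> s t Ss St; apply: ext_gen_relation; rewrite ?ss //; apply: Wrel.
(* Projecting back to [W] gives an endomorphism fixing [S], hence the identity by uniqueness. *)
have g_elt w : ext_elt (g w) = w.
  have [_ uniq_hom] := Wuniv W id Wrel.
  have := uniq_hom (@ext_elt W \o g) idfun; apply=> // s Ss /=.
  by rewrite gS.
exists (fun w => ext_set (g w)); split=> [u v t|s t Ss]; last by rewrite gS.
by rewrite gmulfM /= g_elt.
Qed.

(** * Words and lengths *)

Section Words.

Variables (W : groupType) (S : set W) (N : W -> W -> bool).
Hypothesis involS : forall s, S s -> s * s = 1.
Hypothesis NM : forall u v t, N (u * v) t = N u t (+) N v (t ^ u).
Hypothesis NS : forall s t, S s -> N s t = (t == s).

Local Notation len := (coxeter_length S).
Local Notation word := (word_in S).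
Implicit Types (a b c : seq W) (s t u v w x y z : W).

Lemma word_prod_nil : word_prod [::] = 1 :> W.
Proof. by rewrite /word_prod big_nil. Qed.

Lemma word_prod_cons s a : word_prod (s :: a) = s * word_prod a.
Proof. by rewrite /word_prod big_cons. Qed.

Lemma word_prod1 s : word_prod [:: s] = s.
Proof. by rewrite word_prod_cons word_prod_nil mulg1. Qed.

Lemma word_prod_cat a b : word_prod (a ++ b) = word_prod a * word_prod b.
Proof. by rewrite /word_prod big_cat. Qed.

Lemma word_cat a b : word (a ++ b) <-> word a /\ word b.
Proof.
split=> [ab|[aS bS] s]; last by rewrite mem_cat => /orP[/aS|/bS].
by split=> s sab; apply: ab; rewrite mem_cat sab ?orbT.
Qed.

Lemma word_cons s a : word (s :: a) <-> S s /\ word a.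
Proof.
split=> [sa|[Ss aS] t]; last by rewrite inE => /orP[/eqP->|/aS].
by split=> [|t ta]; apply: sa; rewrite inE ?eqxx ?ta ?orbT.
Qed.

Lemma word_subseq a b : subseq a b -> word b -> word a.
Proof. by move=> /mem_subseq ab bS s /ab/bS. Qed.

Definition generated w := exists2 a, word a & word_prod a = w.

Lemma generated_word a : word a -> generated (word_prod a).
Proof. by exists a. Qed.

Lemma generated_gen s : S s -> generated s.
Proof.
by move=> Ss; exists [:: s]; rewrite ?word_prod1 // => t; rewrite inE => /eqP->.
Qed.

Lemma generated_mul u v : generated u -> generated v -> generated (u * v).
Proof.
case=> a aS <- [b bS <-]; rewrite -word_prod_cat.
by apply: generated_word; apply/word_cat.
Qed.

Lemma generated_inv u : generated u -> generated u^-1.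
Proof.
case=> a + <-; elim: a => [|s a IHa].
  by exists [::]; rewrite // word_prod_nil invg1.
case/word_cons=> Ss aS; rewrite word_prod_cons invgM.
apply: generated_mul (IHa aS) _.
by rewrite (mulg1_eq (involS Ss)); apply: generated_gen.
Qed.

(** A generated element has a nonempty set of word lengths, so the default value of [xget] is never
    reached. *)
Lemma length_spec w : generated w ->
  (exists a, [/\ word a, word_prod a = w & size a = len w]) /\
  (forall a, word a -> word_prod a = w -> (len w <= size a)%N).
Proof.
case=> a aS aw; rewrite /coxeter_length; set P := (X in xget _ X).
have [k Pk] : exists k, P k.
  pose isl k := `[< exists a, [/\ word a, word_prod a = w & size a = k] >].
  have exl : exists k, isl k by exists (size a); apply/asboolP; exists a.
  exists (ex_minn exl); case: ex_minnP => k /asboolP lk mink; split=> // j lj.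
  by apply: mink; apply/asboolP.
have [lenw minw] := xgetI 0%N Pk.
by split=> // b bS bw; apply: minw; exists b.
Qed.

Lemma length_le_size a : word a -> (len (word_prod a) <= size a)%N.
Proof. by move=> aS; apply: (length_spec (generated_word aS)).2. Qed.

Lemma reduced_word_ex w : generated w ->
  exists a, [/\ word a, word_prod a = w & size a = len w].
Proof. by case/length_spec. Qed.

Lemma length_mul u v : generated u -> generated v -> (len (u * v) <= len u + len v)%N.
Proof.
move=> /reduced_word_ex[a [aS <- <-]] /reduced_word_ex[b [bS <- <-]].
by rewrite -word_prod_cat -size_cat length_le_size //; apply/word_cat.
Qed.

Lemma length_gen s : S s -> (len s <= 1)%N.
Proof.
by move=> Ss; rewrite -[s in len s]word_prod1 length_le_size //; apply/word_cons; split.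
Qed.

Lemma reduced_catl a b : word (a ++ b) -> reduced S (a ++ b) -> reduced S a.
Proof.
case/word_cat=> aS bS; rewrite /reduced size_cat word_prod_cat => ab.
apply/eqP; rewrite eqn_leq length_le_size // andbT -(leq_add2r (size b)) ab.
rewrite (leq_trans (length_mul _ _)) ?leq_add2l ?length_le_size //;
  exact: generated_word.
Qed.

Lemma reduced_catr a b : word (a ++ b) -> reduced S (a ++ b) -> reduced S b.
Proof.
case/word_cat=> aS bS; rewrite /reduced size_cat word_prod_cat => ab.
apply/eqP; rewrite eqn_leq length_le_size // andbT -(leq_add2l (size a)) ab.
rewrite (leq_trans (length_mul _ _)) ?leq_add2r ?length_le_size //;
  exact: generated_word.
Qed.

(** * Reflections, inversions and the exchange condition *)

Definition reflection t := exists2 u, generated u & exists2 s, S s & t = s ^ u^-1.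

Lemma reflection_generated t : reflection t -> generated t.
Proof.
case=> u ugen [s Ss ->]; rewrite conjgE invgK; apply: (generated_mul ugen).
by apply: generated_mul (generated_inv ugen); apply: generated_gen.
Qed.

Lemma reflection_gen s : S s -> reflection s.
Proof.
exists 1; first by exists [::]; rewrite ?word_prod_nil.
by exists s; rewrite ?invg1 ?conjg1.
Qed.

Lemma reflection_invol t : reflection t -> t * t = 1.
Proof. by case=> u _ [s Ss ->]; rewrite -conjMg involS // conj1g. Qed.

Lemma cocycle1 t : N 1 t = false.
Proof. by have := NM 1 1 t; rewrite mul1g conjg1 addbb. Qed.

(** Expanding [N] over [u * s * u^-1], the contributions of [u] and [u^-1] cancel because [N 1]
    vanishes, leaving [N s s]. *)
Lemma cocycle_reflection t : reflection t -> N t t.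
Proof.
case=> u _ [s Ss ->]; set t' := s ^ u^-1.
have t'u : t' ^ u = s by rewrite conjgKV.
have := NM u u^-1 t'; rewrite mulgV cocycle1 t'u => Nu.
have t'E : t' = u * (s * u^-1) by rewrite /t' conjgE invgK.
rewrite {1}t'E !NM t'u (NS _ Ss) eqxx conjgE mulKg.
by move: Nu; case: (N u t'); case: (N _ s).
Qed.

(** Along the word, [N] is a sum mod 2 of tests comparing [t] with the reflection of each letter, so
    one test succeeds. With [reflection_mul_delete] this is the strong exchange condition. *)
Lemma cocycle_delete a t : word a -> N (word_prod a) t ->
  exists a1 s a2, a = a1 ++ s :: a2 /\ t = s ^ (word_prod a1)^-1.
Proof.
elim: a t => [|s a IHa] t; first by rewrite word_prod_nil cocycle1.
case/word_cons=> Ss aS; rewrite word_prod_cons NM NS //.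
have [-> _|_ /=] := eqVneq t s.
  by exists [::], s, a; rewrite word_prod_nil invg1 conjg1.
case/(IHa _ aS)=> a1 [r [a2 [-> tr]]]; exists (s :: a1), r, a2; split=> //.
by rewrite word_prod_cons invgM conjgM -tr conjgK.
Qed.

Lemma reflection_mul_delete a1 s a2 : S s ->
  s ^ (word_prod a1)^-1 * word_prod (a1 ++ s :: a2) = word_prod (a1 ++ a2).
Proof.
move=> Ss; rewrite !word_prod_cat word_prod_cons conjgE invgK -!mulgA mulKg.
by rewrite [s * (s * _)]mulgA involS // mul1g.
Qed.

Lemma cocycle_length w t : generated w -> N w t -> (len (t * w) < len w)%N.
Proof.
case/reduced_word_ex=> a [aS <- sa] /(cocycle_delete aS)[a1 [s [a2 [aE ->]]]].
move: aS sa; rewrite {a}aE => aS <-.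
have /word_cat[a1S /word_cons[Ss a2S]] := aS.
rewrite reflection_mul_delete // size_cat addnS ltnS -size_cat length_le_size //.
by apply/word_cat.
Qed.

(** Left multiplication by [t] toggles the value of [N] at [t], so [cocycle_length] applies either
    to [w] or to [t * w]. *)
Lemma cocycleE w t : generated w -> reflection t -> N w t = (len (t * w) < len w)%N.
Proof.
move=> wgen tr; apply/idP/idP=> [|lt_tw]; first exact: cocycle_length.
apply: contraLR lt_tw => nNw; rewrite -leqNgt ltnW //.
have := @cocycle_length (t * w) t; rewrite mulgA reflection_invol // mul1g; apply.
  by apply: generated_mul => //; apply: reflection_generated.
by rewrite NM cocycle_reflection // conjgE mulgA mulVg mul1g.
Qed.

Lemma cocycleNE w t : generated w -> reflection t -> ~~ N w t = (len w < len (t * w))%N.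
Proof.
move=> wgen tr; have tgen := reflection_generated tr.
have := @cocycleE (t * w) t (generated_mul tgen wgen) tr.
rewrite mulgA reflection_invol // mul1g => <-.
by rewrite NM cocycle_reflection // conjgE mulgA mulVg mul1g.
Qed.

Lemma reduced_cons s a : word (s :: a) ->
  reduced S (s :: a) <-> reduced S a /\ ~~ N (word_prod a) s.
Proof.
move=> saS; have /word_cons[Ss aS] := saS; have agen := generated_word aS.
rewrite cocycleNE //; last exact: reflection_gen.
split=> [sa|[ra lt_sa]].
  have ra : reduced S a by apply: (@reduced_catr [:: s]).
  by split=> //; rewrite -ra -word_prod_cons -sa.
apply/eqP; rewrite eqn_leq length_le_size // andbT /= word_prod_cons.
by rewrite [size a]ra.
Qed.

(** Letters are prepended one at a time to a reduced subword; when [s] would shorten it, exchange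
    erases one of its letters instead. *)
Lemma reduced_subseq a : word a ->
  exists b, [/\ subseq b a, reduced S b & word_prod b = word_prod a].
Proof.
elim: a => [|s a IHa] saS.
  exists [::]; split=> //; apply/eqP; rewrite eq_sym -leqn0.
  exact: (@length_le_size [::]).
have /word_cons[Ss aS] := saS; have [b [ba rb eqab]] := IHa aS.
have bS := word_subseq ba aS; have bgen := generated_word bS.
have [Nbs|nNbs] := boolP (N (word_prod b) s); last first.
  have sba : subseq (s :: b) (s :: a) by rewrite /= eqxx.
  exists (s :: b); split=> //; last by rewrite !word_prod_cons eqab.
  by apply/reduced_cons => //; apply: word_subseq saS.
have [b1 [r [b2 [bE sE]]]] := cocycle_delete bS Nbs.
have rS : S r by apply: bS; rewrite bE mem_cat inE eqxx orbT.
have b12 : word_prod (b1 ++ b2) = s * word_prod b.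
  by rewrite bE -(reflection_mul_delete b1 b2 rS) -sE.
have b12b : subseq (b1 ++ b2) b by rewrite bE cat_subseq // subseq_cons.
exists (b1 ++ b2); split; last by rewrite b12 eqab word_prod_cons.
  exact: subseq_trans (subseq_trans b12b ba) (subseq_cons _ _).
apply/eqP; rewrite eqn_leq length_le_size ?andbT; last exact: word_subseq bS.
have sz : size b = (size (b1 ++ b2)).+1 by rewrite bE !size_cat addnS.
(* Multiplying back by [s] adds at most one to the length, so one erased letter is all that can be
   gained. *)
rewrite -ltnS -sz rb b12 -add1n -[X in (len X <= _)%N]mul1g -(involS Ss) -mulgA.
apply: leq_trans (length_mul _ _) _; [exact: generated_gen| |].
  by apply: generated_mul; first exact: generated_gen.
by rewrite leq_add2r length_gen.
Qed.

(** * Bruhat order, subwords and lifting *)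

(* [len y < len (t * y)] for reflections [t] on the left; since
   [t * y = y * (t ^ y)], right multiplication gives the same order. *)
Inductive bruhat x : W -> Prop :=
| bruhat_refl : bruhat x x
| bruhat_step y t : bruhat x y -> reflection t -> (len y < len (t * y))%N ->
    bruhat x (t * y).

Lemma bruhat_generated x y : bruhat x y -> generated x -> generated y.
Proof.
by elim=> // {}y t _ IH /reflection_generated tgen _ /IH; apply: generated_mul.
Qed.

(** Each step of the chain, read downwards, erases a letter by exchange. The word is arbitrary
    because the shortened word may fail to be reduced and must still feed the induction. *)
Lemma bruhat_subword x a : generated x -> word a -> bruhat x (word_prod a) ->
  exists2 b, subseq b a & word_prod b = x.
Proof.
move=> xgen aS; move aE: (word_prod a) => y xy.
elim: xy a aS aE => [|{}y t xy IH tr lt_y] a aS aE; first by exists a.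
have : N (word_prod a) t.
  rewrite aE cocycleE ?mulgA ?reflection_invol ?mul1g // -aE.
  exact: generated_word.
case/(cocycle_delete aS)=> a1 [s [a2 [aE' tE]]].
have Ss : S s by apply: aS; rewrite aE' mem_cat inE eqxx orbT.
have a12a : subseq (a1 ++ a2) a by rewrite aE' cat_subseq // subseq_cons.
have [|b bsub bx] := IH _ (word_subseq a12a aS).
  by rewrite -(reflection_mul_delete a1 a2 Ss) -tE -aE' aE mulgA reflection_invol ?mul1g.
by exists b => //; apply: subseq_trans a12a.
Qed.

(** Lifting property, by induction on the chain. The delicate case is a step [t] that lengthens [y]
    but not [y * s]. *)
Lemma bruhat_mulr x y s : S s -> generated x -> bruhat x y ->
  bruhat (x * s) y \/ bruhat (x * s) (y * s).
Proof.
move=> Ss xgen; elim=> [|{}y t xy IH tr lt_y]; first by right; apply: bruhat_refl.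
have ygen := bruhat_generated xy xgen; have sgen := generated_gen Ss.
have tgen := reflection_generated tr.
case: IH => [xsy|xsys]; first by left; apply: bruhat_step.
have [lt_ys|ge_ys] := ltnP (len (y * s)) (len (t * (y * s))).
  by right; rewrite -mulgA; apply: bruhat_step.
left; suff -> : t * y = y * s by [].
have {ge_ys} lt_ys : (len (t * (y * s)) < len (y * s))%N.
  rewrite -cocycleE //; last exact: generated_mul.
  by apply: contraTT ge_ys; rewrite cocycleNE -?ltnNge //; apply: generated_mul.
have zsgen : generated (t * (y * s)) by do !apply: generated_mul.
have [c [cS cE sc]] := reduced_word_ex zsgen.
have zE : word_prod (c ++ [:: s]) = t * y.
  by rewrite word_prod_cat cE word_prod1 -!mulgA involS // mulg1.
have csS : word (c ++ [:: s]) by apply/word_cat; split=> //; apply/word_cons.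
have : N (word_prod (c ++ [:: s])) t.
  rewrite zE cocycleE ?mulgA ?reflection_invol ?mul1g //.
  exact: generated_mul.
case/(cocycle_delete csS)=> a1 [r [a2 [csE tE]]].
have Sr : S r by apply: csS; rewrite csE mem_cat inE eqxx orbT.
have yE : word_prod (a1 ++ a2) = y.
  by rewrite -(reflection_mul_delete a1 a2 Sr) -tE -csE zE mulgA reflection_invol ?mul1g.
(* Exchange erases a letter of [c] followed by [s]. Erasing the final [s] gives the claim; erasing a
   letter of [c] would make [y * s] shorter than [t * (y * s)]. *)
case/lastP: a2 csE yE => [|a2 r'].
  rewrite !cats1 cats0 => /rcons_inj[<- _]; rewrite cE => yE.
  by rewrite -{2}yE -!mulgA involS // mulg1.
rewrite -rcons_cons -!cats1 catA cats1 cats1 => /rcons_inj[cE' <-].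
rewrite catA word_prod_cat word_prod1 => yE; move: lt_ys.
rewrite -sc cE' -{1}yE -mulgA involS // mulg1 ltnNge => /negP[].
rewrite (leq_trans (length_le_size _)) ?size_cat ?leq_add2l //.
have: word c by []; rewrite cE' => /word_cat[a1S /word_cons[_ a2S]].
exact/word_cat.
Qed.

Lemma subword_bruhat a b : word a -> reduced S a -> subseq b a ->
  bruhat (word_prod b) (word_prod a).
Proof.
elim/last_ind: a b => [|a s IHa] b.
  by rewrite subseq0 => _ _ /eqP->; apply: bruhat_refl.
rewrite -cats1 => asS ras; have /word_cat[aS sS] := asS.
have ra := reduced_catl asS ras; have Ss : S s by apply: sS; rewrite inE eqxx.
have agen := generated_word aS.
have lt_as : (len (word_prod a) < len (word_prod a * s))%N.
  by rewrite -[X in _ * X]word_prod1 -word_prod_cat -ras -ra size_cat addn1.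
(* Right multiplication by [s] is left multiplication by the reflection conjugate to [s], as
   [bruhat_step] expects. *)
have a_as : forall x, bruhat x (word_prod a) -> bruhat x (word_prod a * s).
  move=> x xa; have -> : word_prod a * s = s ^ (word_prod a)^-1 * word_prod a.
    by rewrite conjgE invgK -!mulgA mulVg mulg1.
  apply: bruhat_step => //; first by exists (word_prod a) => //; exists s.
  by rewrite conjgE invgK -!mulgA mulVg mulg1.
rewrite word_prod_cat word_prod1 cats1.
case/lastP: b => [|b r] bas.
  by apply/a_as/IHa => //; apply: sub0seq.
move: bas; rewrite -subseq_rev !rev_rcons /=; case: eqP => [-> | _] bas.
  have {}bas : subseq b a by rewrite -subseq_rev.
  rewrite -cats1 word_prod_cat word_prod1.
  have bgen := generated_word (word_subseq bas aS).
  by case: (bruhat_mulr Ss bgen (IHa _ aS ra bas)) => [/a_as|].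
by apply/a_as/IHa => //; rewrite -subseq_rev rev_rcons.
Qed.

(** The elements below [word_prod a] are stable under right multiplication by a right descent [s]:
    lifting lands below [a] or below [a * s], itself below [a]. *)
Lemma subword_lift a b s : word a -> reduced S a -> subseq b a -> S s ->
    (len (word_prod a * s) < len (word_prod a))%N ->
  exists c, [/\ subseq c a, reduced S c & word_prod c = word_prod b * s].
Proof.
move=> aS ra ba Ss lt_as.
have agen := generated_word aS; have bgen := generated_word (word_subseq ba aS).
have bsa : bruhat (word_prod b * s) (word_prod a).
  have [//|bsas] := bruhat_mulr Ss bgen (subword_bruhat aS ra ba).
  have aE : word_prod a = s ^ (word_prod a)^-1 * (word_prod a * s).
    by rewrite conjgE invgK -!mulgA mulKg involS // mulg1.
  rewrite aE; apply: bruhat_step => //; last by rewrite -aE.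
  by exists (word_prod a) => //; exists s.
have [|c ca cE] := bruhat_subword _ aS bsa.
  by apply: generated_mul => //; apply: generated_gen.
have [d [dc rd dE]] := reduced_subseq (word_subseq ca aS).
by exists d; split; rewrite ?dE //; apply: subseq_trans ca.
Qed.

End Words.

(** * Subwords indexed by sets of positions *)

Section Sets.

Variables (W : groupType) (S : set W) (N : W -> W -> bool).
Hypothesis involS : forall s, S s -> s * s = 1.
Hypothesis NM : forall u v t, N (u * v) t = N u t (+) N v (t ^ u).
Hypothesis NS : forall s t, S s -> N s t = (t == s).

Variables (m : nat) (omega : m.-tuple W).
Hypothesis omegaS : word_in S omega.

Implicit Types (A B C D : {set 'I_m}) (i j k x : 'I_m) (lo hi : nat).

Local Notation len := (coxeter_length S).
Local Notation sub := (subword omega).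
Local Notation gen := (tnth omega).
Local Notation eval A := (word_prod (subword omega A)).
Local Notation redset A := (reduced S (subword omega A)).

Lemma sorted_enum_ord A : sorted (fun i j => (i < j)%N) (enum A).
Proof.
rewrite /enum_mem sorted_filter //; first by move=> y x z; apply: ltn_trans.
by have := iota_ltn_sorted 0 m; rewrite -val_enum_ord sorted_map enumT.
Qed.

Lemma enum_ord_eq A (e : seq 'I_m) :
  sorted (fun i j => (i < j)%N) e -> A =i e -> enum A = e.
Proof.
move=> se Ae; apply: (@irr_sorted_eq _ (fun i j : 'I_m => i < j)%N) => //.
- by move=> y x z; apply: ltn_trans.
- by move=> x /=; apply: ltnn.
- exact: sorted_enum_ord.
- by move=> i; rewrite mem_enum.
Qed.

Lemma enum_ord_setU A B : (forall i j, i \in A -> j \in B -> (i < j)%N) ->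
  enum (A :|: B) = enum A ++ enum B.
Proof.
move=> ltAB; apply: enum_ord_eq.
  have tr : transitive (fun i j : 'I_m => i < j)%N by move=> y x z; apply: ltn_trans.
  rewrite sorted_pairwise // pairwise_cat -!sorted_pairwise // !sorted_enum_ord !andbT.
  by apply/allrelP=> i j; rewrite !mem_enum; apply: ltAB.
by move=> i; rewrite inE mem_cat !mem_enum.
Qed.

Lemma subword_setU A B : (forall i j, i \in A -> j \in B -> (i < j)%N) ->
  sub (A :|: B) = sub A ++ sub B.
Proof. by move=> ltAB; rewrite /subword enum_ord_setU ?map_cat. Qed.

Lemma subword_set0 : sub finset.set0 = [::].
Proof. by rewrite /subword enum_set0. Qed.

Lemma subword_set1 x : sub [set x] = [:: gen x].
Proof. by rewrite /subword enum_set1. Qed.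

Lemma gen_in x : S (gen x).
Proof. by apply: omegaS; apply: mem_tnth. Qed.

Lemma subword_word A : word_in S (sub A).
Proof. by move=> s /mapP[i _ ->]; apply: gen_in. Qed.

Lemma size_subword A : size (sub A) = #|A|.
Proof. by rewrite size_map -cardE. Qed.

Definition below A x := [set i in A | (i < x)%N].
Definition above A x := [set i in A | (x < i)%N].

Lemma enum_ord_mem A x : x \in A ->
  enum A = enum (below A x) ++ x :: enum (above A x).
Proof.
move=> xA; have AE : A = below A x :|: ([set x] :|: above A x).
  apply/setP=> i; rewrite !inE -val_eqE.
  by case: (ltngtP i x) => [||/val_inj->]; rewrite ?andbT ?andbF ?orbF.
rewrite {1}AE !enum_ord_setU ?enum_set1 //.
- by move=> i j; rewrite !inE => /eqP-> /andP[].
- move=> i j; rewrite !inE => /andP[_ ix] /orP[/eqP->//|/andP[_]].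
  exact: ltn_trans.
Qed.

Lemma subword_mem A x : x \in A -> sub A = sub (below A x) ++ gen x :: sub (above A x).
Proof. by move=> xA; rewrite /subword (enum_ord_mem xA) map_cat. Qed.

Lemma subword_notin A x : x \notin A -> sub A = sub (below A x) ++ sub (above A x).
Proof.
move=> xA; rewrite -subword_setU.
  congr subword; apply/setP=> i; rewrite !inE.
  case: (ltngtP i x) => [||/val_inj->]; rewrite ?andbT ?andbF ?orbF //.
  exact/negbTE.
by move=> i j; rewrite !inE => /andP[_ ix] /andP[_]; apply: ltn_trans.
Qed.

Lemma subword_subseq A B : A \subset B -> subseq (sub A) (sub B).
Proof.
move=> /fintype.subsetP AB; apply: map_subseq.
have -> : enum A = [seq i <- enum B | i \in A]; last exact: filter_subseq.
apply: enum_ord_eq => [|i].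
  by apply: sorted_filter (sorted_enum_ord B) => y x z; apply: ltn_trans.
by rewrite mem_filter mem_enum; case: (boolP (i \in A)) => // /AB->.
Qed.

Lemma subseq_subword a A : subseq a (sub A) ->
  exists2 B : {set 'I_m}, B \subset A & a = sub B.
Proof.
case/subseqP=> b _ ->; rewrite -map_mask.
exists [set i in mask b (enum A)].
  by apply/fintype.subsetP=> i; rewrite inE => /mem_mask; rewrite mem_enum.
congr map; symmetry; apply: enum_ord_eq => [|i]; last by rewrite inE.
apply: subseq_sorted (mask_subseq _ _) (sorted_enum_ord A).
by move=> y x z; apply: ltn_trans.
Qed.

Lemma eval_delete A t : N (eval A) t ->
  exists2 k, k \in A & eval (A :\ k) = t * eval A.
Proof.
case/(cocycle_delete NM NS (@subword_word A))=> a1 [s [a2 [aE tE]]].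
have [k kA /andP[/eqP a1E /eqP sE]] :
    exists2 k, k \in A & (a1 == sub (below A k)) && (s == gen k).
  have szE : size a1 < size (enum A).
    by rewrite -(size_map gen) [map _ _]aE size_cat /= addnS ltnS leq_addr.
  have k0 : 'I_m by case: (enum A) szE.
  (* The erased letter has rank [size a1] in the increasing enumeration of [A]; [k0] only serves as
     default for [nth]. *)
  set k := nth k0 (enum A) (size a1).
  have kA : k \in A by rewrite -mem_enum mem_nth.
  have below_take : enum (below A k) = take (size a1) (enum A).
    have xbelow : k \notin enum (below A k) by rewrite mem_enum inE ltnn andbF.
    rewrite -(index_uniq k0 szE (enum_uniq A)) -/k (enum_ord_mem kA).
    by rewrite index_cat (negbTE xbelow) /= eqxx addn0 take_size_cat.
  exists k => //; rewrite /subword below_take map_take [map _ _]aE take_size_cat // eqxx.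
  by rewrite -(nth_map k0 (gen k0)) // [map _ _]aE nth_cat ltnn subnn eqxx.
exists k => //; rewrite [in RHS](subword_mem kA) tE a1E sE.
rewrite (reflection_mul_delete involS) //; last exact: gen_in.
rewrite (@subword_notin _ k) ?setD11 //; congr (word_prod (_ ++ _)); congr subword.
all: by apply/setP=> i; rewrite !inE -val_eqE /=; case: (ltngtP i k); rewrite ?andbF ?andbT.
Qed.

(** Erasing [k] multiplies the tail by [gen i] on the left; inserting [i] cancels that factor. *)
Lemma eval_swap A i : i \notin A -> N (eval (above A i)) (gen i) ->
  exists k, [/\ k \in A, (i < k)%N & eval (i |: (A :\ k)) = eval A].
Proof.
move=> iA /eval_delete[k]; rewrite inE => /andP[kA ik] evalE.
exists k; split=> //.
have iB : i \in i |: (A :\ k) by rewrite !inE eqxx.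
rewrite (subword_mem iB) (subword_notin iA) !word_prod_cat word_prod_cons.
have -> : below (i |: (A :\ k)) i = below A i.
  apply/setP=> j; rewrite !inE -!val_eqE /=; case: (ltngtP j i); rewrite ?andbF //.
  by move=> ji; rewrite neq_ltn (ltn_trans ji ik).
have -> : above (i |: (A :\ k)) i = above A i :\ k.
  by apply/setP=> j; rewrite !inE -!val_eqE /=; case: (ltngtP j i); rewrite ?andbF ?andbT.
by rewrite evalE [gen i * _]mulgA involS ?mul1g //; apply: gen_in.
Qed.

Lemma card_swap A i k : i \notin A -> k \in A -> #|i |: (A :\ k)| = #|A|.
Proof.
by move=> iA kA; rewrite cardsU1 !inE (negbTE iA) andbF /= [RHS](cardsD1 k) kA.
Qed.

Lemma redset_card A B : eval A = eval B -> #|A| = #|B| -> redset A -> redset B.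
Proof. by rewrite /reduced !size_subword => -> ->. Qed.

Lemma redset_below A x : redset A -> redset (below A x).
Proof.
have [xA|xA] := boolP (x \in A); rewrite ?(subword_mem xA) ?(subword_notin xA) => rA.
  apply: (reduced_catl _ rA); rewrite -(subword_mem xA); exact: subword_word.
apply: (reduced_catl _ rA); rewrite -(subword_notin xA); exact: subword_word.
Qed.

Lemma redset_above A x : redset A -> redset (above A x).
Proof.
have [xA|xA] := boolP (x \in A) => rA.
  have aS := @subword_word A; move: rA aS; rewrite (subword_mem xA) -cat_rcons => rA aS.
  exact: reduced_catr aS rA.
have aS := @subword_word A; move: rA aS; rewrite (subword_notin xA) => rA aS.
exact: reduced_catr aS rA.
Qed.

Lemma generated_eval A : generated S (eval A).
Proof. exact/generated_word/subword_word. Qed.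

(** Otherwise [s :: a ++ b] would be reduced, and so would its prefix [s :: a]. *)
Lemma cocycle_eval_prefix a b s : word_in S (a ++ b) -> reduced S (a ++ b) -> S s ->
  N (word_prod a) s -> N (word_prod (a ++ b)) s.
Proof.
move=> abS rab Ss; apply: contraLR => nN.
have sabS : word_in S ((s :: a) ++ b) by apply/word_cons.
have rsab : reduced S ((s :: a) ++ b) by apply/(reduced_cons involS NM NS sabS).
have := reduced_catl sabS rsab.
have saS : word_in S (s :: a) by case/word_cat: sabS.
by case/(reduced_cons involS NM NS saS).
Qed.

(** * The local criterion for sortedness *)

(* With [lo = 0] this is being omega-sorted; [lo] makes the criterion stable under
   passing to the part of [A] after a given position. *)
Definition sorted_from lo A : Prop :=
  [/\ redset A, forall i, i \in A -> (lo <= i)%N &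
      forall i, (lo <= i)%N -> i \notin A -> ~~ N (eval (above A i)) (gen i)].

Lemma ex_is_min (X : {set 'I_m}) : X != finset.set0 -> exists x, is_min X x.
Proof.
case/set0Pn=> i0 Xi0; case: (arg_minnP (fun i : 'I_m => i : nat) Xi0) => x Xx minx.
by exists x; split=> // y Xy; rewrite leEord; apply: minx.
Qed.

Lemma ex_first_diff A B : A != B ->
  exists2 x, (x \in A) != (x \in B) & is_min ((A :|: B) :\: (A :&: B)) x.
Proof.
move=> AB; have [|x [Xx minx]] := @ex_is_min ((A :|: B) :\: (A :&: B)).
  apply: contraNneq AB => /setP X0; apply/eqP/setP=> i.
  by have := X0 i; rewrite !inE; case: (i \in A); case: (i \in B).
exists x; last by split.
by move: Xx; rewrite !inE; case: (x \in A); case: (x \in B).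
Qed.

Lemma first_diff_below A B x : is_min ((A :|: B) :\: (A :&: B)) x ->
  below A x = below B x.
Proof.
case=> _ minx; apply/setP=> i; rewrite !inE.
have [ix|] := boolP (i < x)%N; rewrite ?andbF ?andbT //.
have : i \notin (A :|: B) :\: (A :&: B).
  by apply: contraL ix => /minx; rewrite leEord -leqNgt.
by rewrite !inE; case: (i \in A); case: (i \in B).
Qed.

(** Cancelling the common part before [x] equates the two tails, and that of [B] is a reduced word
    starting with [gen x]. *)
Lemma first_diff_descent A B x : redset B -> eval A = eval B ->
  is_min ((A :|: B) :\: (A :&: B)) x -> x \in B -> x \notin A ->
  N (eval (above A x)) (gen x).
Proof.
move=> rB + minx xB xA; have eqb := first_diff_below minx.
rewrite (subword_mem xB) (subword_notin xA) eqb !word_prod_cat => /mulgI ->.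
have gS : word_in S (gen x :: sub (above B x)).
  by apply/word_cons; split; [exact: gen_in | exact: subword_word].
have rx : reduced S (gen x :: sub (above B x)).
  have := @subword_word B; move: rB; rewrite (subword_mem xB) => rB bS.
  exact: reduced_catr bS rB.
have [_] := (reduced_cons involS NM NS gS).1 rx.
rewrite word_prod_cons NM (NS _ (gen_in x)) eqxx [gen x ^ _]conjgE mulKg.
by case: (N _ _).
Qed.

Lemma sorted_from_uniq lo A B :
  sorted_from lo A -> sorted_from lo B -> eval A = eval B -> A = B.
Proof.
move=> [rA loA dA] [rB loB dB] eqAB; apply/eqP; apply: contraT => /ex_first_diff[x].
have [xA|xA] := boolP (x \in A); have [xB|xB] := boolP (x \in B) => // _ minx.
  apply: contraNT (dB x (loA x xA) xB) => _.
  by apply: (first_diff_descent rA) => //; rewrite finset.setUC finset.setIC.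
by apply: contraNT (dA x (loB x xB) xA) => _; apply: (first_diff_descent rB).
Qed.

(** Both bounds survive sorting: an exchange inserts a position at least [lo] and to the left of one
    already present. *)
Lemma sorted_from_exists lo hi C :
    redset C -> (forall i, i \in C -> (lo <= i < hi)%N) ->
  exists A : {set 'I_m},
    [/\ sorted_from lo A, forall i, i \in A -> (i < hi)%N & eval A = eval C].
Proof.
(* Each exchange moves a position to the left, decreasing the sum of positions. *)
have [n] := ubnP (\sum_(i in C) i); elim: n C => // n IHn C leCn rC rgC.
have [/forallP dC|] := boolP
  [forall i : 'I_m, (lo <= i)%N ==> (i \notin C) ==> ~~ N (eval (above C i)) (gen i)].
  exists C; split=> //; last by move=> i /rgC/andP[].
  split=> // i; first by case/rgC/andP.
  by move=> loi iC; have := dC i; rewrite loi iC.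
rewrite negb_forall => /existsP[i]; rewrite 2!negb_imply => /and3P[loi iC /negPn Ni].
have [k [kC ik evalE]] := eval_swap iC Ni.
have [|||A [gA hiA eqA]] := IHn (i |: (C :\ k)).
- rewrite big_setU1 /=; last by rewrite !inE (negbTE iC) andbF.
  move: leCn; rewrite (big_setD1 k) //= ltnS; apply: leq_trans.
  by rewrite ltn_add2r.
- by apply: redset_card rC; rewrite ?evalE // card_swap.
- move=> j; rewrite !inE => /orP[/eqP->|/andP[_ /rgC//]].
  by rewrite loi (ltn_trans ik) //; case/andP: (rgC _ kC).
by exists A; rewrite eqA.
Qed.

(** For [i < x] the new tail after [i] is a prefix of the tail in [B], so a violation would persist
    in [B] by [cocycle_eval_prefix]; for [i > x] the tail is empty. *)
Lemma sorted_from_below lo B x :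
  sorted_from lo B -> x \in B -> sorted_from lo (x |: below B x).
Proof.
move=> [rB loB dB] xB.
have aboveE i : (i < x)%N ->
    sub (above B i) = sub (above (x |: below B x) i) ++ sub (above B x).
  move=> ix; rewrite -subword_setU.
    congr subword; apply/setP=> j; rewrite !inE -val_eqE /=.
    case: (ltngtP j x) => [||/val_inj->]; rewrite ?andbT ?andbF ?orbF ?xB //=.
    by move=> xj; rewrite (ltn_trans ix xj) ?andbT.
  move=> j k; rewrite !inE => /andP[/orP[/eqP->|/andP[_ jx]] _] /andP[_ xk] //.
  exact: ltn_trans xk.
have subE : sub B = sub (x |: below B x) ++ sub (above B x).
  rewrite -subword_setU.
    congr subword; apply/setP=> j; rewrite !inE -val_eqE /=.
    by case: (ltngtP j x) => [||/val_inj->]; rewrite ?andbT ?andbF ?orbF ?xB.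
  move=> j k; rewrite !inE => /orP[/eqP->|/andP[_ jx]] /andP[_ xk] //.
  exact: ltn_trans xk.
split.
- have := @subword_word B; move: rB; rewrite subE => rB bS; exact: reduced_catl bS rB.
- by move=> i; rewrite !inE => /orP[/eqP->|/andP[iB _]]; apply: loB.
move=> i loi; rewrite !inE negb_or => /andP[ix].
rewrite negb_and -leqNgt => iB.
have [xi|lix] := ltnP x i.
  suff -> : above (x |: below B x) i = finset.set0.
    by rewrite subword_set0 word_prod_nil (cocycle1 NM).
  apply/setP=> j; rewrite !inE; apply/negP=> /andP[/orP[/eqP jx|/andP[_ jx]] ij].
    by have := ltn_trans xi ij; rewrite jx ltnn.
  by have := ltn_trans (ltn_trans xi ij) jx; rewrite ltnn.
have ltix : (i < x)%N by rewrite ltn_neqAle lix andbT.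
have iNB : i \notin B by move: iB; rewrite leqNgt ltix orbF.
have aS := @subword_word (above B i); have ra := redset_above i rB.
rewrite (aboveE i ltix) in aS ra.
apply: contra (dB i loi iNB); rewrite (aboveE i ltix).
by apply: cocycle_eval_prefix => //; apply: gen_in.
Qed.

Lemma sorted_from_above lo B j :
  sorted_from lo B -> (lo <= j)%N -> j \notin B -> sorted_from j (above B j).
Proof.
move=> [rB loB dB] loj jB; split; first exact: redset_above.
  by move=> i; rewrite inE => /andP[_ /ltnW].
move=> i ji; rewrite inE => iB.
have -> : above (above B j) i = above B i.
  apply/setP=> k; rewrite !inE -andbA; case: (ltnP i k); rewrite ?andbF ?andbT // => ik.
  by rewrite (leq_ltn_trans ji ik) andbT.
apply: dB; first exact: leq_trans loj ji.
case: ltngtP ji iB => // [_ _|]; first by rewrite andbT.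
by move=> /val_inj<-.
Qed.

Lemma sorted_from0 A : sorted_from 0 A <-> omega_sorted S omega A.
Proof.
split=> [[rA _ dA]|[rA minA]].
  split=> //; split=> // B [rB evalB].
  have [->|/ex_first_diff[x dx minx]] := eqVneq A B; first by left.
  right; exists x => //; apply: contraT => xA.
  apply: contraNT (dA x isT xA) => _; apply: (first_diff_descent rB) => //.
  by move: dx; rewrite (negbTE xA); case: (x \in B).
split=> // i _ iA; apply/negP=> /(eval_swap iA)[k [kA ik evalE]].
set B := i |: (A :\ k) in evalE.
have rB : redset B by apply: redset_card rA; rewrite ?evalE // card_swap.
have iB : i \in B by rewrite !inE eqxx.
have kB : k \notin B by rewrite !inE eqxx orbF -val_eqE /= gtn_eqF.
have [AB|[x [Xx minx] xA]] := minA.2 B (conj rB evalE).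
  by move: iA; rewrite AB iB.
(* [A] and [B] differ only at [i] and [k]; a first difference lying in [A] would be [k], yet [i] is
   smaller. *)
have xk : x = k.
  move: Xx; rewrite !inE xA /= negb_or; case: eqP => //.
  by case: eqP.
have := minx i; rewrite leEord xk leqNgt ik.
by rewrite finset.in_setD finset.in_setU finset.in_setI iB (negbTE iA) => /(_ isT).
Qed.

(** * Inserting the first missing position *)

(** Inserting [x] multiplies [eval D] on the left by the reflection [r], so it suffices that [r] is
    not an inversion of [eval D]. [D] is merely reduced so that a sorted tail preceded by an extra
    position qualifies. *)
Lemma insert_reduced lo D B x : redset D -> (forall i, i \in D -> (lo <= i)%N) ->
    x \notin D -> sorted_from lo B -> x \in B -> below B x \subset D ->
    ~~ N (eval (above D x)) (gen x) ->
  redset (x |: D).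
Proof.
move=> rD loD xD gB xB BD nNv.
set u := eval (below D x); set r := gen x ^ u^-1.
have Sx := gen_in x.
have rr : reflection S r by exists u; [exact: generated_eval | exists (gen x)].
have ru : r * u = u * gen x by rewrite /r conjgE invgK -!mulgA mulVg mulg1.
have xE : sub (x |: D) = sub (below D x) ++ gen x :: sub (above D x).
  have xU : x \in x |: D by rewrite !inE eqxx.
  rewrite (subword_mem xU); congr (_ ++ _ :: _); congr subword;
  by apply/setP=> i; rewrite !inE -val_eqE /=; case: (ltngtP i x); rewrite ?andbF.
have DE : sub D = sub (below D x) ++ sub (above D x) by apply: subword_notin.
have rDE : r * eval D = eval (x |: D).
  by rewrite xE DE !word_prod_cat word_prod_cons mulgA ru -mulgA.
suff nNr : ~~ N (eval D) r.
  apply/eqP; rewrite eqn_leq (length_le_size (@subword_word _)) andbT.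
  move: nNr; rewrite (cocycleNE involS NM NS (generated_eval D) rr) rDE -rD.
  by rewrite !size_subword cardsU1 xD add1n.
(* The cocycle splits at [x]: the tail contributes nothing by hypothesis, so only a right descent of
   [u] at [gen x] remains to be excluded. *)
rewrite DE word_prod_cat NM -/u [r ^ u]conjgKV (negbTE nNv) addbF.
rewrite (cocycleE involS NM NS (generated_eval _) rr) ru; apply/negP=> lt_u.
have Bsub : subseq (sub (below B x)) (sub (below D x)).
  apply: subword_subseq; apply/fintype.subsetP=> i iB.
  by rewrite inE (fintype.subsetP BD) //; move: iB; rewrite inE => /andP[].
have [c [csub rc cE]] := subword_lift involS NM NS (@subword_word _)
  (redset_below x rD) Bsub Sx lt_u.
have [C CD cC] := subseq_subword csub; rewrite cC in rc cE.
(* Sorting the lifted subword stays strictly before [x], whereas uniqueness identifies the result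
   with a set containing [x]. *)
have [|A [gA Ax evalA]] := @sorted_from_exists lo x C rc.
  by move=> i /(fintype.subsetP CD); rewrite inE => /andP[/loD->].
have : x |: below B x = A.
  apply: sorted_from_uniq (sorted_from_below gB xB) gA _; rewrite evalA cE.
  have xU : x \in x |: below B x by rewrite !inE eqxx.
  rewrite (subword_mem xU).
  have -> : above (x |: below B x) x = finset.set0.
    by apply/setP=> i; rewrite !inE -val_eqE /=; case: (ltngtP i x); rewrite ?andbF.
  have -> : below (x |: below B x) x = below B x.
    by apply/setP=> i; rewrite !inE -val_eqE /=; case: (ltngtP i x); rewrite ?andbF ?andbT.
  by rewrite subword_set0 word_prod_cat word_prod1.
by move=> eqA; have := Ax x; rewrite -eqA !inE eqxx ltnn => /(_ isT).
Qed.

Lemma sorted_from_insert A B x :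
  sorted_from 0 A -> sorted_from 0 B -> is_min (B :\: A) x ->
  sorted_from 0 (x |: A).
Proof.
move=> gA gB [xBA minx]; have [rA _ dA] := gA; have [_ _ dB] := gB.
move: xBA; rewrite !inE => /andP[xA xB].
have BA i : i \in B -> (i < x)%N -> i \in A.
  move=> iB; apply: contraLR => iA; rewrite -leqNgt.
  by have := minx i; rewrite leEord; apply; rewrite !inE iA.
split=> //.
  apply: (@insert_reduced 0 A B x) => //; last exact: dA.
  by apply/fintype.subsetP=> i; rewrite inE => /andP[]; apply: BA.
move=> j _; rewrite !inE negb_or => /andP[jx jA].
have [{}jx|xj] : (j < x)%N \/ (x < j)%N by apply/orP; rewrite -neq_ltn.
  have jB : j \notin B by apply: contra jA => jB; apply: BA.
  (* The criterion for [x |: A] at [j] amounts to [x |: D] being reduced, so insertion is applied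
     again, now with [lo = j] and [above B j] in place of [B]. *)
  set D := j |: above A j.
  have subD : sub D = gen j :: sub (above A j).
    rewrite subword_setU ?subword_set1 // => i k; rewrite !inE => /eqP-> /andP[]//.
  have subxD : sub (x |: D) = gen j :: sub (above (x |: A) j).
    have -> : x |: D = [set j] :|: above (x |: A) j.
      apply/setP=> i; rewrite !inE; have [->|ij] := eqVneq i x; first by rewrite jx orbT.
      by [].
    rewrite subword_setU ?subword_set1 // => i k; rewrite !inE => /eqP-> /andP[]//.
  have DS := @subword_word D; rewrite subD in DS.
  have rD : redset D.
    rewrite subD; apply/(reduced_cons involS NM NS DS).
    by split; [exact: redset_above | exact: dA].
  have : redset (x |: D).
    apply: (@insert_reduced j D (above B j) x) => //.
    - by move=> i; rewrite !inE => /orP[/eqP->|/andP[_ /ltnW]].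
    - by rewrite !inE negb_or (negbTE xA) andbT -val_eqE /= gtn_eqF.
    - exact: (@sorted_from_above 0).
    - by rewrite inE xB.
    - apply/fintype.subsetP=> i; rewrite !inE -andbA => /and3P[iB ji ix].
      by rewrite ji (BA i) ?orbT.
    have -> : above D x = above A x; last exact: dA.
    apply/setP=> i; rewrite !inE -val_eqE /=; case: (ltnP x i); rewrite ?andbF //.
    by move=> xi; rewrite (ltn_trans jx xi) gtn_eqF ?andbT //; apply: ltn_trans xi.
  have xDS := @subword_word (x |: D); rewrite subxD in xDS; rewrite subxD.
  by case/(reduced_cons involS NM NS xDS).
(* Here [x < j], and the tail after [j] does not see the insertion. *)
have -> : above (x |: A) j = above A j; last exact: dA.
apply/setP=> i; rewrite !inE; have [->|//] := eqVneq i x.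
by rewrite (ltnNge j) (ltnW xj) !andbF.
Qed.

End Sets.

Theorem theorem4p4 (W : groupType) (S : set W) (m : nat) (omega : m.-tuple W)
    (coxWS : coxeter_system S) (omegaS : word_in S omega) :
  supersolvable_antimatroid (sorted_sets S omega).
Proof.
have [involS [N [NM NS]]] := reflection_cocycle coxWS.
have sortedE := sorted_from0 involS NM NS omegaS; split.
  apply/sortedE; split.
  - rewrite subword_set0; apply/eqP; rewrite eq_sym -leqn0.
    exact: (@length_le_size _ _ [::]).
  - by move=> i; rewrite inE.
  move=> i _ _.
  have -> : above finset.set0 i = finset.set0 by apply/setP=> j; rewrite !inE.
  by rewrite subword_set0 word_prod_nil (cocycle1 NM).
move=> A B /sortedE gA /sortedE gB BA.
have [|x minx] := @ex_is_min _ (B :\: A); first by rewrite finset.setD_eq0.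
exists x => //; apply/sortedE; exact: sorted_from_insert minx.
Qed.
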